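(* For almost all $\underline{E}$, $$\lim_{\tau_0\downarrow0}\lim_{E\downarrow-\infty}\tau_0^\alpha\sum_{j=1}^{N_E}\delta_{\lambda_j^{(E)}}=\alpha x^{\alpha-1}\,dx\qquad\text{vaguely in }\mathcal{M}([0,\infty)),$$ where both the inner limit ($E\downarrow-\infty$ with $\tau_0>0$ fixed) and the outer limit are in the vague topology.
   Context: Fix $0<\alpha<1$. Let $\sum_i\delta_{E_i}$ be a Poisson point process on $\mathbb{R}$ with intensity measure $\alpha e^{-\alpha E}\,dE$; almost surely its support is infinite and bounded above, and its points are labelled in decreasing order $E_1>E_2>\cdots$; write $\underline{E}=(E_1,E_2,\dots)$. For $E\in\mathbb{R}$ let $N_E=\max\{i:E_i\ge E\}$ (so a.s. $1\le N_E<\infty$ for all sufficiently small $E$). Given a time unit $\tau_0>0$, set $x_i:=\tau_0e^{-E_i}$. Let $\mathbb{L}_E$ be the $N_E\times N_E$ matrix with entries $(\mathbb{L}_E)_{ii}=\frac{(N_E-1)x_i}{N_E}$ and $(\mathbb{L}_E)_{ij}=-\frac{x_i}{N_E}$ for $i\ne j$ (it depends on $\tau_0$). Almost surely, $\mathbb{L}_E$ has $N_E$ distinct real eigenvalues, denoted $0=\lambda_1^{(E)}<\lambda_2^{(E)}<\cdots<\lambda_{N_E}^{(E)}$. $\mathcal{M}([0,\infty))$ denotes the space of locally bounded measures on $[0,\infty)$. *)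

(* Defs.v *)
From HB Require Import structures.
From mathcomp Require Import all_boot all_order all_algebra.
From mathcomp Require Import polyrcf.
From mathcomp Require Import all_classical all_reals all_analysis.
From mathcomp Require Import measurable_realfun.

Set Implicit Arguments.
Unset Strict Implicit.
Unset Printing Implicit Defensive.

Import Order.TTheory GRing.Theory Num.Theory.
Import numFieldNormedType.Exports.

Local Open Scope classical_set_scope.
Local Open Scope ring_scope.

Section density_measure.
Context {R : realType} (f : R -> R).
Context (f_ge0 : forall x, 0 <= f x) (mf : measurable_fun setT f).
Local Open Scope ereal_scope.

(* The two unused proofs make the measure instance below inferable. *)
Definition density_measure of (forall x, (0 <= f x)%R) & measurable_fun setT f :
    set R -> \bar R :=
  fun A => \int[@lebesgue_measure R]_(x in A) (f x)%:E.

Local Notation nu := (density_measure f_ge0 mf).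

Let nu0 : nu set0 = 0.
Proof. exact: integral_set0. Qed.

Let nu_ge0 A : 0 <= nu A.
Proof. by apply: integral_ge0 => x _; rewrite lee_fin. Qed.

Let nu_sigma_additive : semi_sigma_additive nu.
Proof.
move=> F mF tF mUF; rewrite /density_measure ge0_integral_bigcup//=.
- apply: is_cvg_ereal_nneg_natsum_cond => n _ _.
  by apply: integral_ge0 => x _; rewrite lee_fin.
- by apply/measurable_EFinP; exact: measurable_funS mf.
- by move=> x _; rewrite lee_fin.
Qed.

HB.instance Definition _ :=
  isMeasure.Build _ _ _ nu nu0 nu_ge0 nu_sigma_additive.

End density_measure.

Section reference_measures.
Context {R : realType} (alpha : R) (alpha_gt0 : 0 < alpha).

Definition intensity_density (x : R) : R := alpha * expR (- alpha * x).

Lemma intensity_density_ge0 x : 0 <= intensity_density x.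
Proof. by rewrite mulr_ge0 ?expR_ge0 // ltW. Qed.

Lemma measurable_intensity_density : measurable_fun setT intensity_density.
Proof.
by apply: measurable_funM => //; apply: measurableT_comp => //.
Qed.

Definition intensity : {measure set R -> \bar R} :=
  density_measure intensity_density_ge0 measurable_intensity_density.

(* The indicator is needed: powR takes the value 1 on negative bases. *)
Definition limit_density (x : R) : R :=
  alpha * x `^ (alpha - 1) * \1_(`[0, +oo[) x.

Lemma limit_density_ge0 x : 0 <= limit_density x.
Proof. by rewrite !mulr_ge0 ?powR_ge0 // ltW. Qed.

Lemma measurable_limit_density : measurable_fun setT limit_density.
Proof.
apply: measurable_funM; first by apply: measurable_funM.
exact: measurable_indic.
Qed.

Definition limit_measure : {measure set R -> \bar R} :=
  density_measure limit_density_ge0 measurable_limit_density.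

End reference_measures.

Section poisson_point_process.
Context {d : measure_display} {T : measurableType d} {R : realType}.
Context (P : probability T R).

(* poisson_prob is used rather than poisson_pmf since only the former is right
   at rate 0; it does not depend on its second argument. *)
Definition poisson_point_process (xi : T -> {measure set R -> \bar R})
    (mu : {measure set R -> \bar R}) : Prop :=
  [/\ forall A, measurable A -> measurable_fun setT (fun w => xi w A),
      forall A, measurable A -> (mu A < +oo)%E -> forall k : nat,
        P [set w | xi w A = k%:R%:E] = poisson_prob (fine (mu A)) k [set k],
      forall A, measurable A -> mu A = +oo%E ->
        {ae P, forall w, xi w A = +oo%E} &
      forall (n : nat) (A : 'I_n -> set R) (B : 'I_n -> set (\bar R)),
        (forall i, measurable (A i)) -> trivIset setT A ->
        (forall i, measurable (B i)) ->
        P [set w | forall i, B i (xi w (A i))] =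
        (\prod_(i < n) P [set w | B i (xi w (A i))])%E].

End poisson_point_process.

Definition point_measure {R : realType} (e : nat -> R) :
    {measure set R -> \bar R} :=
  mseries (fun i => \d_(e i)) 0.

Section vague_convergence.
Context {R : realType}.

(* Elements of M([0, oo)) are encoded as Borel measures on the line that do not
   charge ]-oo, 0[. *)
Definition locally_bounded_on_halfline (mu : {measure set R -> \bar R}) : Prop :=
  mu `]-oo, 0[%classic = 0%E /\
  forall b : R, (mu `[0%R, b]%classic < +oo)%E.

(* Compactness of the support is relative to [0, oo), so f 0 may be nonzero. *)
Definition Cc_halfline (f : R -> R) : Prop :=
  {within `[0, +oo[, continuous f} /\ exists b : R, forall x, b < x -> f x = 0.

Definition vague_cvg {I : Type} (F : set_system I)
    (mu_ : I -> {measure set R -> \bar R}) (mu : {measure set R -> \bar R}) :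
    Prop :=
  [/\ \forall i \near F, locally_bounded_on_halfline (mu_ i),
      locally_bounded_on_halfline mu &
      forall f : R -> R, Cc_halfline f ->
        (\int[mu_ i]_(x in `[0%R, +oo[) (f x)%:E)%E @[i --> F] -->
        (\int[mu]_(x in `[0%R, +oo[) (f x)%:E)%E].

End vague_convergence.

Section eigenvalues.
Context {R : realType} (n : nat) (A : 'M[R]_n).

(* The distinct real eigenvalues of A, in increasing order. *)
Definition eigenvalues : seq R := rootsR (char_poly A).

Lemma mem_eigenvalues : eigenvalues =i eigenvalue A.
Proof.
move=> x; rewrite -[RHS]/(eigenvalue A x) eigenvalue_root_char.
have p0 : char_poly A != 0 by rewrite monic_neq0 // char_poly_monic.
by have := roots_on_rootsR p0 x; rewrite in_itv /= => ->.
Qed.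

Lemma eigenvalues_sorted : sorted <%R eigenvalues.
Proof. exact: sorted_roots. Qed.

End eigenvalues.

(* Indices start at 0: E_(i+1), x_(i+1) and lambda_(j+1) are e i, rate tau0 i
   and lambda tau0 E j. *)
Section random_matrix.
Context {R : realType} (e : nat -> R).

(* The maximum of the 1-based labels i.+1 with E <= e i, and 0 if there is no
   maximum. *)
Definition NE (E : R) : nat :=
  xget 0%N [set n | (exists2 i, n = i.+1 & E <= e i) /\
                    forall i, E <= e i -> (i < n)%N].

Definition rate (tau0 : R) (i : nat) : R := tau0 * expR (- e i).

Definition LE (tau0 E : R) : 'M[R]_(NE E) :=
  \matrix_(i, j) (if i == j
                  then ((NE E)%:R - 1) * rate tau0 i / (NE E)%:R
                  else - (rate tau0 i / (NE E)%:R)).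

Definition lambda (tau0 E : R) (j : nat) : R :=
  nth 0 (eigenvalues (LE tau0 E)) j.

Definition spectral_measure (alpha tau0 E : R) : {measure set R -> \bar R} :=
  mscale (NngNum (powR_ge0 tau0 alpha))
    (msum (fun j => \d_(lambda tau0 E j)) (NE E)).

End random_matrix.

(* Main.v *)
Require Import Defs.
From mathcomp Require Import all_boot all_order all_algebra.
From mathcomp Require Import polyrcf.
From mathcomp Require Import all_classical all_reals all_analysis.
From mathcomp Require Import measurable_realfun.
From mathcomp Require Import ring lra.

(** Write [x_i] for the increasing rates [tau0 e^(-E_i)] and [N] for the number
of points above [E]. A row vector [v] satisfies [v L = c v] exactly when
[v_j (x_j - c)] is the constant [(1/N) sum_i v_i x_i]. So [v_j = 1/(x_j - c)]
is an eigenvector as soon as [c = 0] or [sum_(i < N) 1/(c - x_i) = 0]. The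
second equation says that [c] is a critical point of [prod_(i < N) (X - x_i)],
and Rolle's theorem puts one in each of the [N - 1] gaps [(x_j, x_(j+1))].
Together with [0] this gives [N] eigenvalues, hence all of them
([eigenvalues_trap]).

When [E] decreases past a new point, the secular sum gains the term
[1/(c - x_N)], which is negative in every gap already present. The sum is
decreasing there, so its zero moves to the left: each eigenvalue is a
nonincreasing function of [N], bounded below by the left end of its gap, and
therefore converges ([is_cvg_trap_eig]). A test function with compact support
sees only finitely many gaps, so the inner limit is the scaled point measure at
these limits ([vague_cvg_spectral]).

Since the limits still interlace with the rates, the inner limit gives [[0, c]]
the mass [tau0^alpha n], where [n] differs by at most one from the number of
rates below [c], that is, from the number of points with
[e^(-alpha E_i) <= u], where [u = (c / tau0)^alpha]. If this number is
equivalent to [u] as [u] grows, the mass tends to [c^alpha], which is the mass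
that [alpha x^(alpha - 1) dx] gives to [[0, c]] ([cdf_limit_spectral]).
Convergence of these masses implies vague convergence by Riemann-Stieltjes sums
([vague_cvg_cdf]).

This equivalence is a strong law for the number of points in the half-line
[[E, oo)] as [E] decreases. That number is Poisson with parameter
[e^(-alpha E)]. A Chernoff bound ([poisson_concentration]) at the levels of
integer intensity is summable, so Borel-Cantelli applies ([ae_counts]);
monotonicity of the count fills in between the levels
([counts_sandwich]). *)

Set Implicit Arguments.
Unset Strict Implicit.
Unset Printing Implicit Defensive.

Import Order.TTheory GRing.Theory Num.Theory.
Import numFieldNormedType.Exports.

Local Open Scope classical_set_scope.
Local Open Scope ring_scope.

(** * Spectrum of the generator of the mean-field trap model *)

Section trap_spectrum.
Context {R : realType} (x : nat -> R).

Definition trap_mx (n : nat) : 'M[R]_n :=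
  \matrix_(i, j) (if i == j then (n%:R - 1) * x i / n%:R
                  else - (x i / n%:R)).

(** The logarithmic derivative at [c] of [prod_(i < n) (X - x i)]. *)
Definition secular (n : nat) (c : R) : R := \sum_(i < n) (c - x i)^-1.

Hypothesis x_gt0 : forall i, 0 < x i.
Hypothesis x_lt : {homo x : i j / (i < j)%N >-> i < j}.

Lemma mul_trap_mx n (v : 'rV[R]_n) j : (0 < n)%N ->
  (v *m trap_mx n) 0 j = v 0 j * x j - (\sum_i v 0 i * x i) / n%:R.
Proof.
move=> n0; rewrite mxE (bigD1 j)//= [in RHS](bigD1 j)//= mulrDl opprD.
rewrite addrA; congr (_ + _).
  by rewrite mxE eqxx; field; rewrite pnatr_eq0 -lt0n.
rewrite mulr_suml -sumrN; apply: eq_bigr => i ij.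
by rewrite mxE (negbTE ij) mulrN mulrA.
Qed.

Lemma eigenvalue_trap0 n : (0 < n)%N -> eigenvalue (trap_mx n) 0.
Proof.
case: n => // n _; apply/eigenvalueP; exists (\row_j (x j)^-1); last first.
  apply/negP => /eqP/rowP/(_ ord0); rewrite !mxE => /eqP.
  by rewrite invr_eq0 gt_eqF.
apply/rowP => j; rewrite mul_trap_mx// !mxE.
under eq_bigr do rewrite mxE mulVf ?gt_eqF//.
by rewrite mulVf ?gt_eqF// sumr_const card_ord divff ?pnatr_eq0// subrr mul0r.
Qed.

(** The left eigenvector is [v_j = 1/(c - x_j)]: since [x_i v_i = c v_i - 1], the
secular equation gives [sum_i v_i x_i = - n]. *)
Lemma eigenvalue_trap_secular n (c : R) : (0 < n)%N ->
  (forall i, (i < n)%N -> c != x i) -> secular n c = 0 ->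
  eigenvalue (trap_mx n) c.
Proof.
case: n => // n _ cx c0.
have cx0 (i : 'I_n.+1) : c - x i != 0 by rewrite subr_eq0 cx.
apply/eigenvalueP; exists (\row_j (c - x j)^-1); last first.
  apply/negP => /eqP/rowP/(_ ord0); rewrite !mxE => /eqP.
  by rewrite invr_eq0 (negbTE (cx0 _)).
apply/rowP => j; rewrite mul_trap_mx// !mxE.
have rowx (i : 'I_n.+1) :
    (\row_(k < n.+1) (c - x k)^-1) 0 i * x i = c * (c - x i)^-1 - 1.
  by rewrite mxE; have := cx0 i => ?; field.
rewrite (eq_bigr _ (fun i _ => rowx i)) sumrB -mulr_sumr -/(secular _ _) c0.
rewrite mulr0 sub0r sumr_const card_ord.
rewrite mulNr divff ?pnatr_eq0//; have := cx0 j => ?.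
by field.
Qed.

Lemma trap_le i j : (i <= j)%N -> x i <= x j.
Proof. by rewrite leq_eqVlt => /predU1P[->//|/x_lt/ltW]. Qed.

Lemma gap_disjoint i j c : x j < c < x j.+1 -> c != x i.
Proof.
move=> /andP[jc cj]; apply/eqP => ci; rewrite ci in jc cj.
have [ij|ji] := leqP i j; first by rewrite ltNge (trap_le ij) in jc.
by rewrite ltNge (trap_le ji) in cj.
Qed.

Lemma deriv_prod_XsubC n c : (forall i, (i < n)%N -> c != x i) ->
  (\prod_(i < n) ('X - (x i)%:P))^`().[c] =
  (\prod_(i < n) ('X - (x i)%:P)).[c] * secular n c.
Proof.
rewrite /secular; elim: n => [|n ih] cx.
  by rewrite !big_ord0 derivC hornerC mulr0.
rewrite !big_ord_recr/= derivM !hornerE ih; last by move=> i /ltnW /cx.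
have : c - x n != 0 by rewrite subr_eq0 cx.
by move=> cxn; rewrite derivXsubC !hornerE; field.
Qed.

(** Rolle's theorem between two consecutive roots of [prod_(i < n) (X - x i)]. *)
Lemma secular_root n j : (j.+1 < n)%N ->
  exists2 c, x j < c < x j.+1 & secular n c = 0.
Proof.
move=> jn; pose p := \prod_(i < n) ('X - (x i)%:P).
have root_p i : (i < n)%N -> p.[x i] = 0.
  move=> i_n; rewrite /p (bigD1 (Ordinal i_n))//= hornerM !hornerE.
  by rewrite subrr mul0r.
have [c] : exists2 c, c \in `]x j, x j.+1[ & p^`().[c] = 0.
  have := @poly_rolle R (x j) (x j.+1) p (x_lt (ltnSn j)).
  rewrite !root_p// ?(ltnW jn)// => /(_ erefl) [c cI pc0].
  by exists c.
rewrite in_itv/= => cI p'c0; exists c => //.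
have cx i := gap_disjoint i cI.
move/eqP: p'c0; rewrite deriv_prod_XsubC// mulf_eq0 => /orP[|/eqP//].
rewrite /p horner_prod prodf_seq_eq0 => /hasP[i _] /=.
by rewrite !hornerE subr_eq0 (negbTE (cx i)).
Qed.

(** Within a gap no term of the sum changes sign, and each one is decreasing. *)
Lemma secular_lt n j b c : (0 < n)%N -> x j < b -> b < c -> c < x j.+1 ->
  secular n c < secular n b.
Proof.
move=> n0 jb bc cj; rewrite /secular; apply: ltr_sum.
  by apply/hasP; exists (Ordinal n0) => //; rewrite mem_index_enum.
move=> i _; have [ij|ji] := leqP i j.
  have xb : x i < b by rewrite (le_lt_trans (trap_le ij)).
  by rewrite ltf_pV2 ?posrE ?subr_gt0// ?ltrD2r// (lt_trans xb).
have xc : c < x i by rewrite (lt_le_trans cj (trap_le ji)).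
by rewrite ltf_nV2 ?negrE ?subr_lt0// ?ltrD2r// (lt_trans bc).
Qed.

Definition gap_root n j : R :=
  xget 0 [set c | x j < c < x j.+1 /\ secular n c = 0].

Lemma gap_rootP n j : (j.+1 < n)%N ->
  x j < gap_root n j < x j.+1 /\ secular n (gap_root n j) = 0.
Proof.
move=> /secular_root[c cI c0].
exact: (@xgetI R 0 [set c | x j < c < x j.+1 /\ secular n c = 0] c).
Qed.

Definition trap_eig n j : R := if j is i.+1 then gap_root n i else 0.

Lemma trap_eig_lt n j : (j < n)%N -> trap_eig n j < x j.
Proof. by case: j => //= j /gap_rootP[/andP[]]. Qed.

(** The [n] listed numbers are distinct eigenvalues, and the characteristic
polynomial has degree [n], so there is no other one. *)
Lemma eigenvalues_trap n : (0 < n)%N ->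
  eigenvalues (trap_mx n) = mkseq (trap_eig n) n.
Proof.
move=> n0; have s_sorted : sorted <%R (mkseq (trap_eig n) n).
  apply/(sortedP 0) => i; rewrite size_mkseq => i1n.
  rewrite !nth_mkseq ?(ltnW i1n)//=.
  have [/andP[lo _] _] := gap_rootP i1n.
  exact: lt_trans (trap_eig_lt (ltnW i1n)) lo.
have s_eig : {subset mkseq (trap_eig n) n <= eigenvalues (trap_mx n)}.
  move=> _ /mapP[j + ->]; rewrite mem_iota add0n mem_eigenvalues => /= jn.
  case: j jn => [|j] jn; first exact: eigenvalue_trap0.
  have [cI c0] := gap_rootP jn; apply: eigenvalue_trap_secular => // i _.
  exact: gap_disjoint cI.
apply: lt_sorted_eq => //; first exact: eigenvalues_sorted.
move=> y; apply/idP/idP => [|/s_eig//].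
apply: contraTT => y_notin; apply/negP => y_eig.
have := @max_poly_roots R (char_poly (trap_mx n)) (y :: mkseq (trap_eig n) n).
rewrite monic_neq0 ?char_poly_monic//= y_notin (lt_sorted_uniq s_sorted)/=.
rewrite size_mkseq size_char_poly ltnn => /(_ isT) H; suff: false by [].
have rootE z : z \in eigenvalues (trap_mx n) -> root (char_poly (trap_mx n)) z.
  by rewrite mem_eigenvalues -eigenvalue_root_char.
by apply: H => //; rewrite rootE//=; apply/allP => z /s_eig /rootE.
Qed.

(** The term added to the decreasing secular sum is negative in the gap, so the
zero moves to the left. *)
Lemma gap_root_nincr n j : (j.+1 < n)%N -> gap_root n.+1 j <= gap_root n j.
Proof.
move=> jn; have [/andP[lo hi] c0] := gap_rootP jn.
have [/andP[lo' hi'] c0'] := gap_rootP (ltnW jn : (j.+1 < n.+1)%N).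
have n0 : (0 < n)%N by exact: leq_ltn_trans jn.
rewrite leNgt; apply/negP => lt_c.
have := secular_lt n0 lo lt_c hi'; rewrite c0; apply/negP; rewrite -leNgt.
have : secular n (gap_root n.+1 j) + (gap_root n.+1 j - x n)^-1 = 0.
  by rewrite -c0' /secular big_ord_recr.
move/eqP; rewrite addr_eq0 => /eqP ->; rewrite oppr_ge0 invr_le0 subr_le0.
by rewrite (le_trans (ltW hi'))// trap_le// ltnW.
Qed.

Lemma is_cvg_trap_eig j : cvgn (trap_eig ^~ j).
Proof.
case: j => [|j]; first exact: is_cvg_cst.
(* Gap [j] has a root only from [n = j.+2] on. *)
suff : cvgn [sequence trap_eig (n + j.+2) j.+1]_n.
  by move=> /cvg_ex[l]; rewrite (cvg_shiftn j.+2 (trap_eig ^~ j.+1)) => /cvgP.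
apply: nonincreasing_is_cvgn.
  apply/nonincreasing_seqP => n; rewrite /= addSn.
  by apply: gap_root_nincr; rewrite addnS ltnS leq_addl.
exists (x j) => _ [n _ <-].
have /gap_rootP[/andP[/ltW]] : (j.+1 < n + j.+2)%N by rewrite addnS ltnS leq_addl.
by [].
Qed.

Definition lim_eig j : R := limn (trap_eig ^~ j).

Lemma lim_eig0 : lim_eig 0 = 0.
Proof. exact: lim_cst. Qed.

Lemma lim_eigS j : x j <= lim_eig j.+1 <= x j.+1.
Proof.
have bounds : \forall n \near \oo, x j <= trap_eig n j.+1 <= x j.+1.
  near=> n; have jn : (j.+1 < n)%N by near: n; exact: nbhs_infty_gt.
  by have [/andP[/ltW lo /ltW hi] _] := gap_rootP jn; rewrite /= lo hi.
rewrite /lim_eig; apply/andP; split.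
  apply: limr_ge; first exact: is_cvg_trap_eig.
  by apply: filterS bounds => n /andP[].
apply: limr_le; first exact: is_cvg_trap_eig.
by apply: filterS bounds => n /andP[].
Unshelve. all: by end_near. Qed.

End trap_spectrum.

(** * Vague convergence on the half-line *)

Section halfline_functions.
Context {R : realType}.

(** Test functions on the half-line become continuous functions on the line. *)
Lemma continuous_comp_max0 (f : R -> R) :
  {within `[0, +oo[, continuous f} -> continuous (fun x : R => f (Num.max 0 x)).
Proof.
move=> /subspace_continuousP cf x.
have max0_ge0 (y : R) : `[0, +oo[%classic (Num.max 0 y).
  by rewrite /= in_itv/= andbT le_max lexx.
have cmax : {for x, continuous (fun y : R => Num.max 0 y)}.
  by apply: continuous_max => //; exact: cst_continuous.
move=> U /(cf _ (max0_ge0 x)); rewrite nbhs_filterE/= => /cmax.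
rewrite !nbhs_filterE /= => H; rewrite /fmap/=.
by apply: filterS H => y /=; apply; exact: max0_ge0.
Qed.

Lemma uniform_continuity_itv (f : R -> R) (b e : R) : continuous f -> 0 < e ->
  exists2 r, 0 < r &
    forall x y, 0 <= x <= b -> `|y - x| < r -> `|f y - f x| <= e.
Proof.
move=> cf e0.
pose P (r x : R) := forall y, `|y - x| < r -> `|f y - f x| <= e.
suff : \forall r \near (0:R)^'+, `[0, b] `<=` P r.
  move=> H; near (0:R)^'+ => r; exists r => // x y xb.
  by apply: (near H r) => //=; rewrite in_itv.
have /compact_near_coveringP := @segment_compact R 0 b.
apply => // x _.
have e2 : 0 < e / 2 by rewrite divr_gt0.
have /cvgrPdist_lt /(_ _ e2)[r /= r0 xr] := cf x.
exists (ball x (r / 2), [set s | s < r / 2]).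
  split; first by apply: nbhsx_ballx; rewrite divr_gt0.
  by apply: nbhs_right_lt; rewrite divr_gt0.
move=> [x' s] /= [xx' sr] y yx'.
have /ltW fx' : `|f x - f x'| < e / 2.
  apply: xr; rewrite /= (lt_le_trans xx')// ler_pdivrMr//.
  by rewrite ler_peMr ?ltW// ltr1n.
have /ltW fy : `|f x - f y| < e / 2.
  apply: xr; rewrite /= (splitr r) -(subrKA x') .
  by rewrite (le_lt_trans (ler_normD _ _))// ltrD// distrC (lt_trans yx').
rewrite (splitr e) -(subrKA (f x)) (le_trans (ler_normD _ _))// lerD//.
by rewrite distrC.
Unshelve. all: by end_near. Qed.

End halfline_functions.

Section step_approximation.
Context {R : realType}.
Implicit Types (m : {measure set R -> \bar R}) (f : R -> R) (t : nat -> R).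

(** The lower bound [c - e] is truncated at [0] to stay within integrals of
nonnegative functions. *)
Lemma integral_near_const m f (D : set R) (c e : R) :
  measurable D -> (m D < +oo)%E -> measurable_fun setT f ->
  (forall x, 0 <= f x) -> (forall x, D x -> `|f x - c| <= e) ->
  exists2 I, (\int[m]_(x in D) (f x)%:E)%E = I%:E &
    `|I - c * fine (m D)| <= e * fine (m D).
Proof.
move=> mD mDoo mf f0 fc.
have mfD : measurable_fun D (EFin \o f).
  by apply/measurable_EFinP; exact: measurable_funTS.
have mDfin : m D \is a fin_num by rewrite ge0_fin_numE.
have up : (\int[m]_(x in D) (f x)%:E <= (c + e)%:E * m D)%E.
  rewrite -integral_cst//; apply: ge0_le_integral => //.
  - by move=> x _; rewrite lee_fin.
  - by move=> x /fc; rewrite lee_fin ler_distl => /andP[].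
have lo : ((Num.max (c - e) 0)%:E * m D <= \int[m]_(x in D) (f x)%:E)%E.
  rewrite -integral_cst//; apply: ge0_le_integral => //.
  - by move=> x _; rewrite lee_fin le_max lexx orbT.
  - by move=> x /fc; rewrite lee_fin ge_max f0 andbT ler_distl => /andP[].
have intfin : (\int[m]_(x in D) (f x)%:E)%E \is a fin_num.
  rewrite ge0_fin_numE; last by apply: integral_ge0 => x _; rewrite lee_fin.
  by rewrite (le_lt_trans up)// -(fineK mDfin) -EFinM ltry.
move: up lo; have -> : m D = (fine (m D))%:E by rewrite fineK.
have := fine_ge0 (measure_ge0 m D); move: (fine (m D)) => u u0.
rewrite -(fineK intfin); move: (fine _) => v up lo; exists v => //.
move: up lo; rewrite -!EFinM !lee_fin /= => up lo.
have lo' : (c - e) * u <= Num.max (c - e) 0 * u.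
  by rewrite ler_wpM2r// le_max lexx.
by rewrite ler_norml; nra.
Qed.

(** The Riemann-Stieltjes sum of [f] on [0, t n] against the distribution
function of [m]; the first term accounts for an atom at [t 0]. *)
Definition step_sum m f t n : R :=
  f (t 0%N) * fine (m `[0, t 0%N]%classic) +
  \sum_(k < n) f (t k.+1) *
    (fine (m `[0, t k.+1]%classic) - fine (m `[0, t k]%classic)).

Lemma integral_step_approx m f t (e : R) n :
  (forall b : R, (m `[0%R, b]%classic < +oo)%E) ->
  measurable_fun setT f -> (forall x, 0 <= f x) ->
  t 0%N = 0 -> {homo t : i j / (i <= j)%N >-> i <= j} -> 0 <= e ->
  (forall k x, (k < n)%N -> t k < x <= t k.+1 -> `|f x - f (t k.+1)| <= e) ->
  exists2 I, (\int[m]_(x in `[0%R, t n]) (f x)%:E)%E = I%:E &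
    `|I - step_sum m f t n| <= e * fine (m `[0, t n]%classic).
Proof.
move=> mfin mf f0 t0 t_le e0; elim: n => [|n ih] fe.
  rewrite /step_sum big_ord0 addr0; apply: integral_near_const => // x.
  rewrite t0 /= in_itv/= => x0.
  have -> : x = 0 by apply/eqP; rewrite eq_le andbC.
  by rewrite subrr normr0.
have [|I1 I1E I1e] := ih; first by move=> k x kn; apply: fe; exact: ltnW.
have tn0 i : 0 <= t i by rewrite -t0 t_le.
have splitE : `[0, t n.+1]%classic = `[0, t n] `|` `]t n, t n.+1]%classic.
  by rewrite -itv_bndbnd_setU// bnd_simp ?t_le.
have disj : [disjoint `[0, t n]%classic & `]t n, t n.+1]%classic].
  apply/disj_setPS => x [] /=; rewrite !in_itv/= => /andP[_ xt] /andP[tx _].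
  by move: xt; rewrite leNgt tx.
have mU : m `[0, t n.+1]%classic =
    (m `[0%R, t n]%classic + m `]t n, t n.+1]%classic)%E.
  by rewrite splitE measureU//; apply/disj_set2P.
have mpos : (m `]t n, t n.+1]%classic < +oo)%E.
  by apply: le_lt_trans (mfin (t n.+1)); rewrite mU leeDr.
have [I2 I2E I2e] : exists2 I,
    (\int[m]_(x in `]t n, t n.+1]) (f x)%:E)%E = I%:E &
    `|I - f (t n.+1) * fine (m `]t n, t n.+1]%classic)| <=
      e * fine (m `]t n, t n.+1]%classic).
  apply: integral_near_const => // x; rewrite /= in_itv/= => xn.
  exact: fe.
exists (I1 + I2).
  rewrite splitE ge0_integral_setU// ?I1E ?I2E//.
  - by apply/measurable_EFinP; exact: measurable_funTS.
  - by move=> x _; rewrite lee_fin.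
have -> : fine (m `[0, t n.+1]%classic) =
   fine (m `[0, t n]%classic) + fine (m `]t n, t n.+1]%classic).
  by rewrite mU fineD// ge0_fin_numE.
have -> : step_sum m f t n.+1 =
   step_sum m f t n + f (t n.+1) * fine (m `]t n, t n.+1]%classic).
  rewrite /step_sum big_ord_recr/= addrA mU fineD ?ge0_fin_numE//.
  by congr (_ + _ * _); rewrite addrAC subrr add0r.
rewrite mulrDr opprD addrACA (le_trans (ler_normD _ _))//.
exact: lerD.
Qed.

(** One partition serves all measures, so the approximation is uniform along a
family of measures with bounded mass on [0, b]. *)
Lemma uniform_step_approx (f : R -> R) (b e : R) :
  continuous f -> (forall x, 0 <= f x) -> 0 < b -> 0 < e ->
  exists n (t : nat -> R), (forall k, 0 <= t k) /\
    forall m, (forall c : R, (m `[0%R, c]%classic < +oo)%E) ->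
      exists2 I, (\int[m]_(x in `[0%R, b]) (f x)%:E)%E = I%:E &
        `|I - step_sum m f t n| <= e * fine (m `[0, b]%classic).
Proof.
move=> cf f0 b0 e0.
have [r r0 rf] := @uniform_continuity_itv R f b e cf e0.
pose n := (Num.truncn (b / r)).+1; pose t k : R := b * (k%:R / n%:R).
have n0 : 0 < n%:R :> R by rewrite ltr0n.
have tn : t n = b by rewrite /t divff ?mulr1// gt_eqF.
have t_le : {homo t : i j / (i <= j)%N >-> i <= j}.
  by move=> i j ij; rewrite /t ler_pM2l// ler_pM2r ?invr_gt0// ler_nat.
have t0 : t 0%N = 0 by rewrite /t mul0r mulr0.
exists n, t; split=> // [k|m mfin]; first by rewrite -t0 t_le.
rewrite -tn; apply: integral_step_approx => //.
- exact: continuous_measurable_fun.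
- exact: ltW.
move=> k x kn /andP[tx xt]; apply: rf; first by rewrite -tn -t0 !t_le.
rewrite distrC ger0_norm ?subr_ge0// ltrBlDl -ltrBlDr (le_lt_trans _ tx)//.
rewrite lerBlDr -lerBlDl /t -mulrBr -mulrBl -natrB// subSnn mul1r.
rewrite ler_pdivrMr// mulrC -ler_pdivrMr// ltW//.
by rewrite /n; apply: truncnS_gt.
Qed.

End step_approximation.

Section vague_criterion.
Context {R : realType}.
Implicit Types m : {measure set R -> \bar R}.

Lemma integral_halfline_itv m (f : R -> R) (b : R) :
  (forall x, b < x -> f x = 0) ->
  (\int[m]_(x in `[0%R, +oo[) (f x)%:E = \int[m]_(x in `[0%R, b]) (f x)%:E)%E.
Proof.
move=> fb; rewrite integral_mkcond [RHS]integral_mkcond.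
apply: eq_integral => x _; rewrite !patchE !mem_setE !in_itv/= andbT.
by have [xb|/fb->] := leP x b; rewrite ?andbT// andbF if_same.
Qed.

Lemma locally_bounded_itv m : locally_bounded_on_halfline m ->
  forall b : R, (m `[0%R, b]%classic < +oo)%E.
Proof. by case. Qed.

(** Splitting a test function into positive and negative parts; these are
continuous after composition with [max 0]. *)
Lemma vague_cvg_ge0 {I : Type} (F : set_system I) {FF : Filter F}
    (mu_ : I -> {measure set R -> \bar R}) (mu : {measure set R -> \bar R}) :
  (\forall i \near F, locally_bounded_on_halfline (mu_ i)) ->
  locally_bounded_on_halfline mu ->
  (forall (f : R -> R) b, continuous f -> (forall x, 0 <= f x) ->
    0 < b -> (forall x, b < x -> f x = 0) ->
    (\int[mu_ i]_(x in `[0%R, +oo[) (f x)%:E)%E @[i --> F] -->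
    (\int[mu]_(x in `[0%R, +oo[) (f x)%:E)%E) ->
  vague_cvg F mu_ mu.
Proof.
move=> lb_ lb cvg0; split => // f [cf [b fb]].
pose g x := f (Num.max 0 x).
have cg : continuous g by exact: continuous_comp_max0.
pose c := Num.max b 1.
have c0 : 0 < c by rewrite lt_max ltr01 orbT.
have gc x : c < x -> g x = 0.
  rewrite gt_max => /andP[bx x1]; rewrite /g max_r ?fb//.
  by rewrite (le_trans ler01)// ltW.
have fg (m : {measure set R -> \bar R}) :
    (\int[m]_(x in `[0%R, +oo[) (f x)%:E =
     \int[m]_(x in `[0%R, +oo[) (Num.max (g x) 0)%:E -
     \int[m]_(x in `[0%R, +oo[) (Num.max (- g x) 0)%:E)%E.
  rewrite integralE; congr (_ - _)%E; apply: eq_integral => x;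
    rewrite inE/= in_itv/= andbT => x0; rewrite /g (max_r x0).
  - by rewrite funeposE /= EFin_max.
  - by rewrite funenegE /= EFin_max.
under eq_fun do rewrite fg.
rewrite fg.
have cmax (h : R -> R) :
    continuous h -> continuous (fun x => Num.max (h x) 0).
  move=> ch x; apply: continuous_max => //; first exact: ch.
  exact: cst_continuous.
apply: cvgeB.
- apply: fin_num_adde_defl.
  have cmg : continuous (fun x => Num.max (- g x) 0).
    by apply: cmax => x; apply: continuousN; exact: cg.
  have max0 x : 0 <= Num.max (- g x) 0 by rewrite le_max lexx orbT.
  have [n [t [_ /(_ mu)]]] := uniform_step_approx cmg max0 c0 ltr01.
  rewrite (@integral_halfline_itv _ _ c); last first.
    by move=> x /gc ->; rewrite oppr0 maxxx.
  by move=> /(_ (locally_bounded_itv lb)) [J -> _]; rewrite fin_numN.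
- apply: (cvg0 _ c) => //; first exact: cmax.
    by move=> x; rewrite le_max lexx orbT.
  by move=> x /gc ->; rewrite maxxx.
- apply: (cvg0 _ c) => //.
  + by apply: cmax => x; apply: continuousN; exact: cg.
  + by move=> x; rewrite le_max lexx orbT.
  + by move=> x /gc ->; rewrite oppr0 maxxx.
Qed.

(** Riemann-Stieltjes sums converge term by term, and they approximate the
integrals uniformly since the masses of [0, b] stay bounded. *)
Lemma vague_cvg_cdf {I : Type} (F : set_system I) {FF : Filter F}
    (mu_ : I -> {measure set R -> \bar R}) (mu : {measure set R -> \bar R}) :
  (\forall i \near F, locally_bounded_on_halfline (mu_ i)) ->
  locally_bounded_on_halfline mu ->
  (forall b : R, 0 <= b ->
     fine (mu_ i `[0, b]%classic) @[i --> F] --> fine (mu `[0, b]%classic)) ->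
  vague_cvg F mu_ mu.
Proof.
move=> lb_ lb cdf; apply: vague_cvg_ge0 => // f b cf f0 b0 fb.
under eq_fun do rewrite (integral_halfline_itv _ fb).
rewrite (integral_halfline_itv _ fb).
have [n1 [t1 [_ approx1]]] := uniform_step_approx cf f0 b0 ltr01.
have [J JE _] := approx1 _ (locally_bounded_itv lb).
rewrite JE; apply/fine_cvgP; split.
  apply: filterS lb_ => i /locally_bounded_itv lbi.
  have [n [t [_ /(_ _ lbi)]]] := uniform_step_approx cf f0 b0 ltr01.
  by move=> [Ji -> _].
apply/cvgrPdist_le => d d0; set M := fine (mu `[0, b]%classic).
have M0 : 0 <= M by exact: fine_ge0.
(* Near the limit the mass of [0, b] is at most [M + 1], so the three errors add
   up to [e * (M + 1) + e + e * M = d]. *)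
have e0 : 0 < d / (M *+ 2 + 2) by rewrite divr_gt0// ltr_wpDl// mulrn_wge0.
have [n [t [t0 approx]]] := uniform_step_approx cf f0 b0 e0.
have step_cvg : step_sum (mu_ i) f t n @[i --> F] --> step_sum mu f t n.
  rewrite /step_sum; apply: cvgD.
    by apply: cvgM; [exact: cvg_cst|exact: cdf].
  apply: cvg_big => [|k _]; first exact: add_continuous.
  by apply: cvgM; [exact: cvg_cst|apply: cvgB; exact: cdf].
have /cvgrPdist_le /(_ _ e0) step_near := step_cvg.
have /cvgrPdist_le /(_ _ ltr01) mass_near := cdf b (ltW b0).
near=> i.
have lbi : locally_bounded_on_halfline (mu_ i) by near: i.
have := near step_near i; have := near mass_near i.
have [J' + JJ'] := approx _ (locally_bounded_itv lb); rewrite JE => -[JJ].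
have [Ji JiE JiS] := approx _ (locally_bounded_itv lbi); rewrite /= JiE.
rewrite JJ /= -/M; set e := d / _ in e0 JJ' JiS *.
set S := step_sum mu f t n in JJ' *; set Si := step_sum _ f t n in JiS *.
move: JiS; set Mi := fine _ => JiS /(_ _)/wrap[]// mass /(_ _)/wrap[]// step.
have de : d = e * (M *+ 2 + 2).
  by rewrite /e divfK// gt_eqF// ltr_wpDl// mulrn_wge0.
have : e * Mi <= e * (M + 1).
  by rewrite ler_pM2l//; move: mass; rewrite ler_norml; lra.
rewrite de; move: JJ' JiS step; rewrite -/M !ler_norml; lra.
Unshelve. all: by end_near. Qed.

End vague_criterion.

(** * Masses of the intensity and of the limit measure *)

Section reference_measure_values.
Context {R : realType} (alpha : R) (alpha_gt0 : 0 < alpha).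

Lemma continuous_expR_scale (c : R) : continuous (fun x : R => expR (c * x)).
Proof.
move=> x; apply: continuous_comp; last exact: continuous_expR.
by apply: continuousM => //; exact: cst_continuous.
Qed.

Lemma intensity_itvcy (E : R) :
  intensity alpha_gt0 `[E, +oo[%classic = (expR (- alpha * E))%:E.
Proof.
have := @ge0_continuous_FTC2y R (intensity_density alpha)
  (fun x => - expR (- alpha * x)) E 0.
rewrite EFinN oppeK add0e; apply.
- by move=> x _; exact: intensity_density_ge0.
- rewrite /intensity_density; apply: continuous_subspaceT => x.
  apply: cvgM; first exact: cvg_cst.
  exact: continuous_expR_scale.
- rewrite -oppr0; apply: cvgN.
  rewrite (_ : (fun x => expR (- alpha * x)) =
               (fun z => expR (- z)) \o (fun z => alpha * z)); last first.
    by apply: eq_fun => x; rewrite mulNr.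
  apply: (@cvg_comp _ _ _ _ _ _ (pinfty_nbhs R)); last exact: cvgr_expR.
  exact: gt0_cvgMry.
- by move=> x _; exact: ex_derive.
- by apply/cvg_at_right_filter; apply: cvgN; exact: continuous_expR_scale.
- move=> z _; rewrite /intensity_density derive1E derive_val.
  by rewrite /GRing.scale/=; ring.
Qed.

Lemma continuous_powR_gt0 (a x : R) :
  0 < x -> {for x, continuous (fun y => y `^ a)}.
Proof.
move=> x0; apply/differentiable_continuous/derivable1_diffP.
by apply: derivable_powR; rewrite in_itv/= x0.
Qed.

Lemma limit_measure_itv (a t : R) : 0 < a -> a < t ->
  limit_measure alpha_gt0 `[a, t]%classic = (t `^ alpha - a `^ alpha)%:E.
Proof.
move=> a0 at_; rewrite /limit_measure/= /density_measure EFinB.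
rewrite -(@continuous_FTC2 R (fun x => alpha * x `^ (alpha - 1))
  (fun x => x `^ alpha) a t) //.
- apply: eq_integral => x; rewrite inE/= in_itv/= => /andP[ax _].
  rewrite /limit_density indicE mem_set ?mulr1//= in_itv/= andbT.
  by rewrite ltW// (lt_le_trans a0).
- apply: continuous_in_subspaceT => x; rewrite inE/= in_itv/= => /andP[ax _].
  apply: cvgM; first exact: cvg_cst.
  by apply: continuous_powR_gt0; exact: lt_le_trans ax.
- split.
  + move=> x; rewrite in_itv/= => /andP[ax _].
    by apply: derivable_powR; rewrite in_itv/= andbT (lt_trans a0).
  + by apply: cvg_at_right_filter; exact: continuous_powR_gt0.
  + by apply/cvg_at_left_filter/continuous_powR_gt0; exact: lt_trans at_.
- move=> x; rewrite in_itv/= => /andP[ax _].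
  by rewrite powR_derive1// in_itv/= andbT (lt_trans a0).
Qed.

Lemma limit_measure_set0 : limit_measure alpha_gt0 [set 0] = 0%E.
Proof.
by rewrite /limit_measure/= /density_measure (@integral_Sset1 _ _ _ 0).
Qed.

(** For [alpha < 1] the density is unbounded at [0], so the mass is obtained by
exhausting [(0, t]] with intervals on which it is continuous. *)
Lemma limit_measure_itv0 (t : R) : 0 <= t ->
  limit_measure alpha_gt0 `[0, t]%classic = (t `^ alpha)%:E.
Proof.
rewrite le_eqVlt => /predU1P[<-|t0].
  by rewrite set_itv1 limit_measure_set0 powR0// gt_eqF.
pose u n : R := t / n.+2%:R.
have u0 n : 0 < u n by rewrite divr_gt0.
have ut n : u n < t.
  by rewrite ltr_pdivrMr// ltr_pMr// ltr1n.
have u_cvg : u n @[n --> \oo] --> (0 : R).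
  rewrite -[0](mulr0 t); apply: cvgM; first exact: cvg_cst.
  have := @cvg_harmonic R; rewrite -(cvg_shiftS (@harmonic R)) /=.
  exact.
have bigE : \bigcup_n `[u n, t]%classic = `]0, t]%classic.
  apply/seteqP; split => [x [n _] /=|x /=]; rewrite !in_itv/=.
    by move=> /andP[/(lt_le_trans (u0 n))-> ->].
  move=> /andP[x0 xt].
  have [n _ /(_ n (leqnn n))] : \forall n \near \oo, u n < x.
    by have /cvgr_lt := u_cvg; apply.
  by move=> /= unx; exists n => //=; rewrite in_itv/= (ltW unx).
have lim1 : limit_measure alpha_gt0 `[u n, t]%classic @[n --> \oo] -->
    limit_measure alpha_gt0 `]0, t]%classic.
  rewrite -bigE; apply: nondecreasing_cvg_mu => //.
    by rewrite bigE.
  move=> m n mn; apply/subsetPset => x /=; rewrite !in_itv/= => /andP[+ ->].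
  rewrite andbT; apply: le_trans.
  by rewrite ler_pM2l// lef_pV2 ?posrE// ler_nat.
have lim2 : limit_measure alpha_gt0 `[u n, t]%classic @[n --> \oo] -->
    (t `^ alpha)%:E.
  under eq_fun do rewrite limit_measure_itv//.
  apply: cvg_EFin; first exact: nearW.
  rewrite -[X in _ --> X]subr0; apply: cvgB; first exact: cvg_cst.
  by have /cvg_at_rightP := powR_cvg0 alpha_gt0; apply.
have <- : 0 |` `]0, t]%classic = `[0, t]%classic :> set R.
  by rewrite setU1itv// bnd_simp ltW.
rewrite measureU//.
  rewrite [X in (X + _)%E]limit_measure_set0 add0e.
  by apply: (cvg_unique _ lim1 lim2).
by apply/seteqP; split => x //= [->]; rewrite in_itv/= ltxx.
Unshelve. all: by end_near. Qed.

Lemma locally_bounded_limit_measure :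
  locally_bounded_on_halfline (limit_measure alpha_gt0).
Proof.
split.
  apply: integral0_eq => x; rewrite /= in_itv/= => x0.
  by rewrite /limit_density indicE memNset ?mulr0//= in_itv/= andbT leNgt x0.
move=> b; have [b0|b0] := leP 0 b; first by rewrite limit_measure_itv0// ltry.
by rewrite set_itv_ge ?measure0// bnd_simp -ltNge.
Qed.

End reference_measure_values.

(** * Concentration of the Poisson distribution *)

Section poisson_tails.
Context {R : realType}.

Lemma poisson_prob_series (t : R) k (U : set nat) : 0 < t ->
  poisson_prob t k U = (\sum_(n <oo | n \in U) (poisson_pmf t n)%:E)%E.
Proof.
move=> t0; rewrite /poisson_prob t0 nneseries_esum ?set_mem_set// => n _.
by rewrite lee_fin poisson_pmf_ge0.
Qed.

(** Exponential tilting maps Poisson weights to Poisson weights of another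
parameter; it replaces the computation of the moment generating function. *)
Lemma poisson_pmf_tilt (t s : R) n : 0 < t ->
  expR (s * n%:R) * poisson_pmf t n =
  expR (t * (expR s - 1)) * poisson_pmf (t * expR s) n.
Proof.
move=> t0; rewrite /poisson_pmf t0 mulr_gt0 ?expR_gt0// exprMn -expRM_natr.
have -> : expR (- t) = expR (t * (expR s - 1)) * expR (- (t * expR s)).
  by rewrite -expRD; congr expR; ring.
by ring.
Qed.

(** Chernoff bound: [expR (s * (n - a)) >= 1] on [U], and the tilted weights sum
to at most [1]. The sign of [s] selects the upper or the lower tail. *)
Lemma poisson_tail (t s a : R) k (U : set nat) : 0 < t ->
  (forall n, U n -> s * a <= s * n%:R) ->
  (poisson_prob t k U <= (expR (t * (expR s - 1) - s * a))%:E)%E.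
Proof.
move=> t0 Ua; have ts0 : 0 < t * expR s by rewrite mulr_gt0 ?expR_gt0.
pose c := expR (t * (expR s - 1) - s * a).
have c0 : 0 <= c by exact: expR_ge0.
apply: (@le_trans _ _ (c%:E * poisson_prob (t * expR s) k U)%E); last first.
  by rewrite -[leRHS]mule1 lee_wpmul2l ?lee_fin// probability_le1.
rewrite !poisson_prob_series// -nneseriesZl; last first.
  by move=> n _; rewrite lee_fin poisson_pmf_ge0.
apply: lee_nneseries => [n _ _|n /set_mem/Ua sa].
  by rewrite lee_fin poisson_pmf_ge0.
rewrite -EFinM lee_fin /c expRD mulrAC -poisson_pmf_tilt// mulrAC -expRD.
by rewrite ler_peMl ?poisson_pmf_ge0// -[leLHS]expR0 ler_expR subr_ge0.
Qed.

(** From [expR (- s) >= 1 - s] and [(1 - s) * (1 + s + 2 * s ^+ 2) >= 1]. *)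
Lemma expR_le_quadratic (s : R) : s <= 2^-1 -> expR s <= 1 + s + 2 * s ^+ 2.
Proof.
move=> s2; have s1 : 0 < 1 - s by lra.
have : expR s <= (1 - s)^-1.
  by rewrite -[expR s]invrK lef_pV2 ?posrE ?invr_gt0 ?expR_gt0// -expRN expR_ge1Dx.
move=> /le_trans; apply; rewrite -[_^-1]mul1r ler_pdivrMr//.
by have : 0 <= s ^+ 2 * (1 - 2 * s) by [rewrite mulr_ge0 ?sqr_ge0//; lra]; lra.
Qed.

(** Per unit of [t], the exponent [2 * s ^+ 2 - `|s| * e] of both Chernoff bounds
is smallest at [`|s| = e / 4], where it is [- e ^+ 2 / 8]. *)
Lemma poisson_concentration (t e : R) k : 0 < t -> 0 <= e -> e <= 1 ->
  (poisson_prob t k (~` [set n : nat | (`|n%:R - t| <= e * t)%R]) <=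
   (2 * expR (- (e ^+ 2 / 8) * t))%:E)%E.
Proof.
move=> t0 e0 e1.
have -> : ~` [set n : nat | `|n%:R - t| <= e * t] =
    [set n : nat | (1 + e) * t < n%:R] `|` [set n : nat | n%:R < (1 - e) * t].
  apply/seteqP; split => n /=.
    by move=> /negP; rewrite -ltNge ltr_normr => /orP[h|h]; [left|right]; lra.
  by case => h; apply/negP; rewrite -ltNge ltr_normr; apply/orP; [left|right]; lra.
apply: (@le_trans _ _ (poisson_prob t k [set n : nat | ((1 + e) * t < n%:R)%R] +
    poisson_prob t k [set n : nat | (n%:R < (1 - e) * t)%R])%E).
  exact: measureU2.
have tail (s d : R) (U : set nat) : s <= 2^-1 -> s ^+ 2 = e ^+ 2 / 16 ->
    s * d = e ^+ 2 / 4 -> (forall n, U n -> s * ((1 + d) * t) <= s * n%:R) ->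
    (poisson_prob t k U <= (expR (- (e ^+ 2 / 8) * t))%:E)%E.
  move=> s2 sq sd Us; apply: le_trans (poisson_tail k t0 Us) _.
  rewrite lee_fin ler_expR.
  have /(ler_wpM2l (ltW t0)) : expR s - 1 - s <= 2 * s ^+ 2.
    by have := expR_le_quadratic s2; lra.
  have -> : s * ((1 + d) * t) = s * t + s * d * t by ring.
  by rewrite sq sd; lra.
rewrite mulr_natl mulr2n EFinD; apply: leeD.
  apply: (tail (e / 4) e); [lra|lra|lra|] => n /= /ltW; apply: ler_wpM2l; lra.
apply: (tail (- (e / 4)) (- e)); [lra|lra|lra|] => n /= /ltW; apply: ler_wnM2l.
lra.
Qed.

End poisson_tails.

(** * Almost sure counts of a Poisson point process *)

Section point_process_counts.
Context {d : measure_display} {T : measurableType d} {R : realType}.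
Context (P : probability T R) (xi : T -> {measure set R -> \bar R}).
Context (mu : {measure set R -> \bar R}).
Hypothesis xi_poisson : poisson_point_process P xi mu.

Lemma measurable_count (A : set R) (n : nat) : measurable A ->
  measurable [set w | xi w A = n%:R%:E].
Proof.
move=> mA; have [mxi _ _ _] := xi_poisson.
have := mxi A mA measurableT [set n%:R%:E] (emeasurable_set1 _).
by rewrite setTI.
Qed.

Lemma count_eventE (A : set R) (V : set nat) :
  [set w | exists2 n, V n & xi w A = n%:R%:E] =
  \bigcup_(n in V) [set w | xi w A = n%:R%:E].
Proof. by []. Qed.

Lemma measurable_count_event (A : set R) (V : set nat) : measurable A ->
  measurable [set w | exists2 n, V n & xi w A = n%:R%:E].
Proof.
move=> mA; rewrite count_eventE; apply: bigcup_measurable => n _.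
exact: measurable_count.
Qed.

Lemma count_law (A : set R) (V : set nat) : measurable A -> (mu A < +oo)%E ->
  P [set w | exists2 n, V n & xi w A = n%:R%:E] =
  poisson_prob (fine (mu A)) 0 V.
Proof.
move=> mA Aoo; have [_ law _ _] := xi_poisson.
rewrite count_eventE measure_bigcup; last 2 first.
- by move=> n _; exact: measurable_count.
- apply/trivIsetP => m n _ _ mn; apply/seteqP; split => w //= -[->] [/eqP].
  by rewrite eqr_nat (negbTE mn).
have lawA n : P [set w | xi w A = n%:R%:E] = poisson_prob (fine (mu A)) 0 [set n].
  exact: law.
rewrite (eq_eseriesr (fun n _ => lawA n)).
transitivity (poisson_prob (fine (mu A)) 0 (\bigcup_(n in V) [set n])); last first.
  by rewrite bigcup_imset1 image_id.
rewrite measure_bigcup//.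
by apply/trivIsetP => m n _ _ mn; apply/seteqP; split => w //= [->] /eqP; rewrite (negbTE mn).
Qed.

(** The event on the left also contains the outcomes of infinite count, which the
law of the finite counts shows to be negligible. *)
Lemma count_law_complement (A : set R) (V : set nat) : measurable A -> (mu A < +oo)%E ->
  P (~` [set w | exists2 n, V n & xi w A = n%:R%:E]) =
  poisson_prob (fine (mu A)) 0 (~` V).
Proof.
move=> mA Aoo; rewrite probability_setC ?count_law//; last exact: measurable_count_event.
exact/esym/(@probability_setC _ _ _ (poisson_prob (fine (mu A)) 0)).
Qed.

(** Borel-Cantelli: at intensity [k.+1] the deviation has geometrically small
probability. *)
Lemma ae_counts (A : nat -> set R) (e : R) : 0 < e -> e <= 1 ->
  (forall k, measurable (A k)) -> (forall k, mu (A k) = k.+1%:R%:E) ->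
  {ae P, forall w, exists K, forall k, (K <= k)%N ->
    exists2 n : nat, `|n%:R - k.+1%:R| <= e * k.+1%:R & xi w (A k) = n%:R%:E}.
Proof.
move=> e0 e1 mA muA.
pose V k := [set n : nat | `|n%:R - k.+1%:R| <= e * k.+1%:R].
pose F k := ~` [set w | exists2 n, V k n & xi w (A k) = n%:R%:E].
have mF k : measurable (F k) by apply: measurableC; exact: measurable_count_event.
pose q : R := expR (- (e ^+ 2 / 8)).
have q1 : `|q| < 1.
  by rewrite ger0_norm ?expR_ge0// expR_lt1 oppr_lt0 divr_gt0// exprn_gt0.
have PF k : (P (F k) <= (geometric (2 * q) q k)%:E)%E.
  rewrite /F count_law_complement// muA ?ltry//=.
  apply: le_trans (poisson_concentration _ _ (ltW e0) e1) _ => //.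
  by rewrite lee_fin expRM_natr exprS mulrA.
have sumF : (\sum_(0 <= k <oo) P (F k) < +oo)%E.
  apply: (@le_lt_trans _ _ (\sum_(0 <= k <oo) (geometric (2 * q) q k)%:E)%E).
    exact: lee_nneseries.
  rewrite (_ : (fun n => _) = EFin \o series (geometric (2 * q) q)); last first.
    by apply/funext => n; rewrite /series/= sumEFin.
  by rewrite EFin_lim ?ltry//; exact: is_cvg_geometric_series.
exists (lim_sup_set F); split.
- apply: bigcapT_measurable => n; apply: bigcup_measurable => k _; exact: mF.
- exact: lim_sup_set_cvg0.
- move=> w /= nw n _; apply: contrapT => nF; apply: nw; exists n => k nk.
  by apply: contrapT => bad; apply: nF; exists k.
Qed.

End point_process_counts.

(** * Point measures *)

Section point_measures.
Context {R : realType}.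
Implicit Types (z : nat -> R) (A : set R).

Lemma point_measure_le z A n :
  (forall j, (n <= j)%N -> ~ A (z j)) -> (point_measure z A <= n%:R%:E)%E.
Proof.
move=> nA; rewrite /point_measure/= /mseries (nneseries_split _ n)//.
rewrite add0n [X in (_ + X)%E]eseries0 ?adde0; last first.
  by move=> j nj _; rewrite /= diracE memNset//; exact: nA.
rewrite big_mkord; apply: (@le_trans _ _ (\sum_(i < n) 1%:E)%E).
  by apply: lee_sum => j _; rewrite /= diracE lee_fin lern1 leq_b1.
by rewrite sumEFin sumr_const card_ord.
Qed.

Lemma point_measure_ge z A n :
  (forall j, (j < n)%N -> A (z j)) -> (n%:R%:E <= point_measure z A)%E.
Proof.
move=> nA; rewrite /point_measure/= /mseries (nneseries_split _ n)//.
apply: (@le_trans _ _ (\sum_(i < n) 1%:E)%E).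
  by rewrite sumEFin sumr_const card_ord.
rewrite add0n big_mkord -[leLHS]adde0; apply: leeD; last exact: nneseries_ge0.
by apply: lee_sum => j _; rewrite /= diracE mem_set//; exact: nA.
Qed.

Lemma integral_msum_dirac z n (f : R -> R) : measurable_fun setT f ->
  (forall x, 0 <= f x) -> (forall j, (j < n)%N -> 0 <= z j) ->
  (\int[msum (fun j => \d_(z j)) n]_(x in `[0%R, +oo[) (f x)%:E)%E =
  (\sum_(j < n) f (z j))%:E.
Proof.
move=> mf f0 z0; have mEf : measurable_fun (`[0, +oo[%classic : set R) (EFin \o f).
  by apply/measurable_EFinP; exact: measurable_funTS.
rewrite ge0_integral_measure_sum//; last by move=> x _; rewrite lee_fin.
rewrite -sumEFin; apply: eq_bigr => j _; rewrite integral_dirac//.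
by rewrite diracE mem_set ?mul1e//= in_itv/= andbT z0.
Qed.

Lemma integral_point_measure z n (f : R -> R) : measurable_fun setT f ->
  (forall x, 0 <= f x) -> (forall j, 0 <= z j) ->
  (forall j, (n <= j)%N -> f (z j) = 0) ->
  (\int[point_measure z]_(x in `[0%R, +oo[) (f x)%:E)%E =
  (\sum_(j < n) f (z j))%:E.
Proof.
move=> mf f0 z0 fz; have mEf : measurable_fun (`[0, +oo[%classic : set R) (EFin \o f).
  by apply/measurable_EFinP; exact: measurable_funTS.
rewrite ge0_integral_measure_series//; last by move=> x _; rewrite lee_fin.
have int_dirac j : (\int[\d_(z j)]_(x in `[0%R, +oo[) (f x)%:E = (f (z j))%:E)%E.
  rewrite integral_dirac//.
  by rewrite diracE mem_set ?mul1e//= in_itv/= andbT z0.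
rewrite (eq_eseriesr (fun j _ => int_dirac j)) (nneseries_split _ n); last first.
  by move=> j _; rewrite lee_fin.
rewrite add0n [X in (_ + X)%E]eseries0 ?adde0; last first.
  by move=> j nj _; rewrite fz.
by rewrite big_mkord sumEFin.
Qed.

Lemma count_downclosed (e : nat -> R) (E : R) n :
  {homo e : i j / (i <= j)%N >-> j <= i} ->
  point_measure e `[E, +oo[%classic = n%:R%:E ->
  forall i, (E <= e i) = (i < n)%N.
Proof.
move=> e_le En i; apply/idP/idP => [Ei|]; last apply: contraTT; rewrite -?ltNge -?leqNgt.
- rewrite -(@ler_nat R) -lee_fin -En; apply: point_measure_ge => j ji.
  by rewrite /= in_itv/= andbT (le_trans Ei)// e_le.
- move=> eiE; rewrite -(@ler_nat R) -lee_fin -En; apply: point_measure_le => j ij /=.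
  rewrite in_itv/= andbT; apply/negP; rewrite -ltNge.
  by rewrite (le_lt_trans _ eiE)// e_le.
Qed.

End point_measures.

(** * The limit at fixed time unit *)

Section decreasing_configuration.
Context {R : realType} (e : nat -> R).
Hypothesis e_decr : forall i, e i.+1 < e i.
Hypothesis e_unbounded : forall E, exists i, e i < E.

Lemma conf_le : {homo e : i j / (i <= j)%N >-> j <= i}.
Proof. by apply/nonincreasing_seqP => i; exact: ltW. Qed.

Lemma NE_count E n : (forall i, (E <= e i) = (i < n)%N) -> NE e E = n.
Proof.
case: n => [|n] En.
  by apply: xgetPN => m [[i _]]; rewrite En.
apply: xget_unique => [|m [[i -> Ei] lei]].
  by split => [|i]; [exists n; rewrite ?En|rewrite En].
apply/eqP; rewrite eqn_leq -En Ei/=.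
by apply: lei; rewrite En.
Qed.

Lemma NE_exists E : exists n, forall i, (E <= e i) = (i < n)%N.
Proof.
have Pex : exists i, e i < E by have [i ei] := e_unbounded E; exists i.
exists (ex_minn Pex) => i; case: ex_minnP => m em mmin.
apply/idP/idP => [Ei|im].
  by rewrite ltnNge; apply/negP => /conf_le; rewrite leNgt (lt_le_trans em).
by rewrite leNgt; apply/negP => /mmin; rewrite leqNgt im.
Qed.

Lemma cvg_NE : NE e E @[E --> -oo] --> \oo.
Proof.
move=> U [n _ nU]; rewrite /fmap/=.
have : \forall E \near -oo, E <= e n by apply: nbhs_ninfty_le; exact: num_real.
apply: filterS => E En; have [m mE] := NE_exists E.
by apply: nU => /=; rewrite (NE_count mE); move: En; rewrite mE => /ltnW.
Qed.

Variables (alpha tau : R).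
Hypothesis tau_gt0 : 0 < tau.
Local Notation x := (rate e tau).

Lemma rate_gt0 i : 0 < x i.
Proof. by rewrite mulr_gt0 ?expR_gt0. Qed.

Lemma rate_lt : {homo x : i j / (i < j)%N >-> i < j}.
Proof.
apply: homo_ltn => [? ? ?|i]; first exact: lt_trans.
by rewrite ltr_pM2l// ltr_expR ltrN2.
Qed.

Lemma lambdaE E j : (j < NE e E)%N -> lambda e tau E j = trap_eig x (NE e E) j.
Proof.
move=> jN; rewrite /lambda -[LE e tau E]/(trap_mx x (NE e E)).
by rewrite (eigenvalues_trap rate_gt0 rate_lt) ?nth_mkseq// (leq_ltn_trans _ jN).
Qed.

Lemma trap_eig_ge0 n j : (j < n)%N -> 0 <= trap_eig x n j.
Proof.
case: j => //= j /(gap_rootP rate_lt)[/andP[lo _] _].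
by rewrite ltW// (lt_trans (rate_gt0 j)).
Qed.

Lemma rate_unbounded (b : R) : exists n, forall i, (n <= i)%N -> b < x i.
Proof.
have [b0|b0] := leP b 0.
  by exists 0%N => i _; rewrite (le_lt_trans b0) ?rate_gt0.
have [n en] := e_unbounded (- ln (b / tau)); exists n => i /conf_le ei.
rewrite /rate -ltr_pdivrMl// mulrC -[ltLHS]lnK ?posrE ?divr_gt0// ltr_expR.
by rewrite ltrNr (le_lt_trans ei).
Qed.

Definition limit_spectral : {measure set R -> \bar R} :=
  mscale (NngNum (powR_ge0 tau alpha)) (point_measure (lim_eig x)).

Lemma lim_eig_ge0 j : 0 <= lim_eig x j.
Proof.
case: j => [|j]; first by rewrite lim_eig0.
have /andP[lo _] := lim_eigS rate_lt j.
by rewrite (le_trans _ lo)// ltW ?rate_gt0.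
Qed.

Lemma lim_eig_le j : lim_eig x j <= x j.
Proof.
case: j => [|j]; first by rewrite lim_eig0 ltW ?rate_gt0.
by have /andP[] := lim_eigS rate_lt j.
Qed.

(** [lim_mass_ge] and [lim_mass_le] compare counts of limit eigenvalues and of
rates by interlacing; the extra unit in the second is the eigenvalue [0]. *)
Lemma lim_mass_ge (b : R) n : (forall i, (i < n)%N -> x i <= b) ->
  (n%:R%:E <= point_measure (lim_eig x) `[0%R, b]%classic)%E.
Proof.
move=> xb; apply: point_measure_ge => j /xb jb.
by rewrite /= in_itv/= lim_eig_ge0 (le_trans (lim_eig_le j)).
Qed.

Lemma lim_mass_le (b : R) n : (forall i, (n <= i)%N -> b < x i) ->
  (point_measure (lim_eig x) `[0%R, b]%classic <= n.+1%:R%:E)%E.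
Proof.
move=> xb; apply: point_measure_le => -[//|j] /xb jb /=.
have /andP[lo _] := lim_eigS rate_lt j.
by rewrite in_itv/= => /andP[_]; apply/negP; rewrite -ltNge (lt_le_trans jb).
Qed.

Lemma locally_bounded_limit_spectral : locally_bounded_on_halfline limit_spectral.
Proof.
split.
  apply/eqP; rewrite eq_le measure_ge0 andbT /limit_spectral/= /mscale/=.
  rewrite -(mule0 (tau `^ alpha)%:E) lee_wpmul2l ?lee_fin ?powR_ge0//.
  apply: (@point_measure_le _ _ _ 0%N) => j _ /=; rewrite in_itv/=.
  by apply/negP; rewrite -leNgt lim_eig_ge0.
move=> b; have [n /lim_mass_le bn] := rate_unbounded b.
rewrite /limit_spectral/= /mscale/= lte_mul_pinfty ?lee_fin ?powR_ge0//.
by rewrite (le_lt_trans bn) ?ltry.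
Qed.

Lemma locally_bounded_spectral E :
  locally_bounded_on_halfline (spectral_measure e alpha tau E).
Proof.
split.
  rewrite /spectral_measure/= /mscale/= /msum big1 ?mule0// => j _.
  rewrite /= diracE memNset//= in_itv/= lambdaE//.
  by apply/negP; rewrite -leNgt trap_eig_ge0.
move=> b; rewrite /spectral_measure/= /mscale/= lte_mul_pinfty ?lee_fin ?powR_ge0//.
rewrite /msum; under eq_bigr do rewrite /= diracE.
by rewrite sumEFin ltry.
Qed.

(** The eigenvalue of index [j.+1] stays above [rate e tau j], so a test function
with bounded support sees a number of eigenvalues that does not depend on [E];
each of them converges. *)
Lemma vague_cvg_spectral :
  vague_cvg (ninfty_nbhs R) (fun E => spectral_measure e alpha tau E) limit_spectral.
Proof.
apply: vague_cvg_ge0; first by apply: nearW; exact: locally_bounded_spectral.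
  exact: locally_bounded_limit_spectral.
move=> f b cf f0 _ fb.
have mf : measurable_fun setT f by exact: continuous_measurable_fun.
have mEf : measurable_fun (`[0, +oo[%classic : set R) (EFin \o f).
  by apply/measurable_EFinP; exact: measurable_funTS.
have fE0 y : `[0, +oo[%classic y -> (0 <= (f y)%:E)%E by rewrite lee_fin.
have [n xb] := rate_unbounded b.
have limf0 j : (n.+1 <= j)%N -> f (lim_eig x j) = 0.
  case: j => // j nj; apply: fb; have /andP[lo _] := lim_eigS rate_lt j.
  by rewrite (lt_le_trans _ lo)// xb.
have eigf0 N j : (n.+1 <= j < N)%N -> f (trap_eig x N j) = 0.
  case: j => // j /andP[nj jN]; apply: fb.
  have [/andP[lo _] _] := gap_rootP rate_lt jN.
  by rewrite (lt_trans _ lo)// xb.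
rewrite /limit_spectral ge0_integral_mscale// (@integral_point_measure _ _ n.+1)//; last first.
  exact: lim_eig_ge0.
have specE : \forall E \near -oo,
    ((tau `^ alpha)%:E * (\sum_(j < n.+1) f (trap_eig x (NE e E) j))%:E)%E =
    (\int[spectral_measure e alpha tau E]_(y in `[0%R, +oo[) (f y)%:E)%E.
  have : \forall E \near -oo, (n.+1 <= NE e E)%N.
    exact: (cvg_NE (nbhs_infty_ge n.+1)).
  apply: filterS => E nN.
  rewrite /spectral_measure ge0_integral_mscale// integral_msum_dirac//; last first.
    by move=> j jN; rewrite lambdaE// trap_eig_ge0.
  congr (_ * EFin _)%E; under [RHS]eq_bigr do rewrite lambdaE//.
  rewrite -!(big_mkord xpredT (fun j => f (trap_eig x (NE e E) j))).
  rewrite [RHS](big_cat_nat _ nN)//= [X in _ + X]big_nat_cond.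
  by rewrite [X in _ + X]big1 ?addr0// => j; rewrite andbT => /eigf0.
apply: cvg_trans (near_eq_cvg specE) _.
apply: cvgeZl => //; apply: cvg_EFin; first exact: nearW.
apply: cvg_big => [|j _]; first exact: add_continuous.
apply: (@cvg_comp _ _ _ (fun E => trap_eig x (NE e E) j) f _ (nbhs (lim_eig x j))).
  apply: (@cvg_comp _ _ _ (NE e) (trap_eig x ^~ j) _ \oo); first exact: cvg_NE.
  exact: (@is_cvg_trap_eig R x rate_lt j).
exact: cf.
Qed.

End decreasing_configuration.

(** * The limit as the time unit vanishes *)

Section regular_configuration.
Context {R : realType} (alpha : R) (alpha_gt0 : 0 < alpha).

Definition level (k : nat) : R := - (ln k.+1%:R / alpha).

Lemma intensity_level k :
  intensity alpha_gt0 `[level k, +oo[%classic = k.+1%:R%:E.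
Proof.
rewrite intensity_itvcy /level mulrNN mulrC divfK ?gt_eqF//.
by rewrite lnK// posrE.
Qed.

Lemma level_le k y : (level k <= y) = (expR (- alpha * y) <= k.+1%:R).
Proof.
rewrite /level lerNl ler_pdivlMr// -[k.+1%:R in RHS]lnK ?posrE//.
by rewrite ler_expR !mulNr mulrC.
Qed.

Variable e : nat -> R.
Hypothesis e_decr : forall i, e i.+1 < e i.
Hypothesis e_counts : forall m : nat, exists K, forall k, (K <= k)%N ->
  exists2 n : nat, `|n%:R - k.+1%:R : R| <= m.+1%:R^-1 * k.+1%:R &
    point_measure e `[level k, +oo[%classic = n%:R%:E.

(* The points in the scale in which they have unit rate. *)
Local Notation b i := (expR (- alpha * e i)).

Lemma counts_threshold m : exists K, forall k, (K <= k)%N ->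
  exists2 n : nat, `|n%:R - k.+1%:R : R| <= m.+1%:R^-1 * k.+1%:R &
    forall i, (b i <= k.+1%:R) = (i < n)%N.
Proof.
have [K HK] := e_counts m; exists K => k /HK[n nk en]; exists n => // i.
by rewrite -level_le (count_downclosed (conf_le e_decr) en).
Qed.

Lemma counts_unbounded E : exists i, e i < E.
Proof.
have [K HK] := counts_threshold 0; pose u := expR (- alpha * E).
have [n _ bn] := HK (K + Num.truncn u)%N (leq_addr _ _).
exists n; move: (bn n); rewrite ltnn => /negbT; rewrite -ltNge => bn_gt.
have : u < b n.
  apply: le_lt_trans bn_gt; apply/ltW/(lt_le_trans (truncnS_gt _)).
  by rewrite ler_nat ltnS leq_addl.
by rewrite ltr_expR !mulNr ltrN2 ltr_pM2l.
Qed.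

(** The counts at the two integers around [u] differ from [u] by at most
[d / 2 * (u + 1) + 1]; the lower bound [U] makes the constant terms, and the
extra unit in [n2.+1], smaller than [d / 2 * u]. *)
Lemma counts_sandwich (d : R) : 0 < d -> exists U : R, forall u, U <= u ->
  exists n1 n2, [/\ forall i, (i < n1)%N -> b i <= u,
    forall i, (n2 <= i)%N -> u < b i,
    (1 - d) * u <= n1%:R & n2.+1%:R <= (1 + d) * u].
Proof.
move=> d0; pose m := Num.truncn (2 / d).
have md : m.+1%:R^-1 <= d / 2.
  rewrite -[leRHS]invrK lef_pV2 ?posrE ?invr_gt0 ?divr_gt0// invf_div.
  by rewrite ltW// truncnS_gt.
have [K HK] := counts_threshold m; exists (8 / d + K%:R + 2) => u Uu.
have u0 : 0 <= u by apply: le_trans Uu; rewrite !addr_ge0// ltW// divr_gt0.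
have /andP[ut tu] := truncn_itv u0.
have d8 : 0 < 8 / d by rewrite divr_gt0.
have t_gt0 : (0 < Num.truncn u)%N.
  by rewrite truncn_gt0; have := ler0n R K; lra.
have Kt : (K < Num.truncn u)%N by rewrite -(ltr_nat R); move: tu; rewrite -natr1; lra.
have [|n1 n1k n1b] := HK (Num.truncn u).-1; first by rewrite -ltnS prednK.
have [n2 n2k n2b] := HK (Num.truncn u) (ltnW Kt).
rewrite prednK// in n1k n1b.
set t : R := (Num.truncn u)%:R in ut n1k n1b.
have ut1 : u < t + 1 by rewrite natr1.
have du : 8 <= d * u by rewrite mulrC -ler_pdivrMr//; have := ler0n R K; lra.
have du2 : 2 * d <= d * u by rewrite mulrC ler_pM2l//; have := ler0n R K; lra.
exists n1, n2; split.
- by move=> i; rewrite -n1b => /le_trans; apply.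
- by move=> i; rewrite leqNgt -n2b -ltNge; apply: lt_trans.
- have : m.+1%:R^-1 * t <= d / 2 * u by apply: ler_pM => //; rewrite ?invr_ge0.
  move: n1k; rewrite ler_norml => /andP[].
  by move: (m.+1%:R^-1) => q; clearbody t; lra.
- rewrite -[X in _ - X]natr1 -[X in _ * X]natr1 -/t in n2k.
  have : m.+1%:R^-1 * (t + 1) <= d / 2 * (u + 1).
    by apply: ler_pM; rewrite ?invr_ge0// ?lerD2r// addr_ge0.
  move: n2k; rewrite ler_norml -[n2.+1%:R]natr1 => /andP[_].
  move: (m.+1%:R^-1) => q; clearbody t; lra.
Qed.

Lemma rate_le_count (tau c : R) i : 0 < tau -> 0 <= c ->
  (rate e tau i <= c) = (b i <= (c / tau) `^ alpha).
Proof.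
move=> tau0 c0; have ct0 : 0 <= c / tau by rewrite divr_ge0// ltW.
have -> : b i = expR (- e i) `^ alpha by rewrite -expRM; congr expR; ring.
rewrite /rate -ler_pdivlMl// mulrC; apply/idP/idP => [|].
  by apply: ge0_ler_powR; rewrite ?nnegrE ?expR_ge0// ltW.
apply: contraTT; rewrite -!ltNge.
by apply: gt0_ltr_powR; rewrite ?nnegrE ?expR_ge0.
Qed.

Lemma powR_at_right0 (c d : R) : 0 < d -> 0 <= c ->
  \forall tau \near 0^'+, tau `^ alpha * c < d.
Proof.
move=> d0 c0; have := powR_cvg0 alpha_gt0.
move=> /cvgr_lt /(_ (d / (c + 1))) H.
have dc : 0 < d / (c + 1) by rewrite divr_gt0// ltr_wpDl.
have := H dc; apply: filterS => tau.
rewrite ltr_pdivlMr ?ltr_wpDl// => /(le_lt_trans _); apply.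
by rewrite ler_wpM2l ?powR_ge0// lerDl.
Qed.

Lemma ereal_between (x : \bar R) (l h : R) :
  (l%:E <= x)%E -> (x <= h%:E)%E -> exists2 v, x = v%:E & l <= v <= h.
Proof. by case: x => // v; rewrite !lee_fin => lv vh; exists v; rewrite ?lv. Qed.

(** With [u = (c / tau) `^ alpha] the prefactor is [c `^ alpha / u], and the count
it multiplies is equivalent to [u]. At [c = 0] the count is at most [1]. *)
Lemma cdf_limit_spectral (c : R) : 0 <= c ->
  fine (limit_spectral e alpha tau `[0, c]%classic) @[tau --> 0^'+] --> c `^ alpha.
Proof.
rewrite le_eqVlt => /predU1P[<-|c0]; apply/cvgrPdist_le => d d0.
  near=> tau; have tau0 : 0 < tau by near: tau; exact: nbhs_right_gt.
  have hi := @lim_mass_le R e e_decr tau tau0 0 0%N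
    (fun i _ => rate_gt0 e tau0 i).
  have lo := @lim_mass_ge R e e_decr tau tau0 0 0%N (fun i i0 => ltac:(by [])).
  have [v vE /andP[v0 v1]] := ereal_between lo hi.
  rewrite /limit_spectral /= /mscale/= vE -EFinM/= powR0 ?gt_eqF// sub0r normrN.
  rewrite ger0_norm ?mulr_ge0 ?powR_ge0//.
  apply: (@le_trans _ _ (tau `^ alpha * 1)); first by rewrite ler_wpM2l ?powR_ge0.
  by apply: ltW; near: tau; exact: powR_at_right0.
have ca0 : 0 < c `^ alpha by rewrite powR_gt0.
have [U HU] := counts_sandwich (divr_gt0 d0 ca0).
near=> tau; have tau0 : 0 < tau by near: tau; exact: nbhs_right_gt.
have ta0 : 0 < tau `^ alpha by rewrite powR_gt0.
have uE : tau `^ alpha * (c / tau) `^ alpha = c `^ alpha.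
  rewrite -powRM ?divr_ge0 ?(ltW c0) ?(ltW tau0)//.
  by rewrite mulrC divfK ?gt_eqF.
set u := (c / tau) `^ alpha in uE.
have Uu : U <= u.
  rewrite -(ler_pM2l ta0) uE (@le_trans _ _ (tau `^ alpha * Num.max U 0))//.
    by rewrite ler_pM2l// le_max lexx.
  by apply: ltW; near: tau; apply: powR_at_right0; rewrite ?le_max ?lexx ?orbT.
have [n1 [n2 [n1b n2b n1u n2u]]] := HU u Uu.
have lo : (n1%:R%:E <=
    point_measure (lim_eig (rate e tau)) `[0%R, c]%classic)%E.
  by apply: lim_mass_ge => // i /n1b; rewrite rate_le_count// ltW.
have hi : (point_measure (lim_eig (rate e tau)) `[0%R, c]%classic <=
    n2.+1%:R%:E)%E.
  by apply: lim_mass_le => // i /n2b; rewrite !ltNge rate_le_count// ltW.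
have [v vE /andP[v_lo v_hi]] := ereal_between lo hi.
rewrite /limit_spectral /= /mscale/= vE -EFinM/=.
rewrite -uE -mulrBr normrM gtr0_norm//.
have : `|u - v| <= d / c `^ alpha * u by rewrite ler_norml; lra.
move/(ler_wpM2l (ltW ta0)) => /le_trans; apply.
by rewrite mulrCA uE divfK ?gt_eqF.
Unshelve. all: by end_near. Qed.

Lemma vague_cvg_limit_spectral :
  vague_cvg (at_right (0 : R)) (limit_spectral e alpha) (limit_measure alpha_gt0).
Proof.
apply: vague_cvg_cdf.
- near=> tau; have tau0 : 0 < tau by near: tau; exact: nbhs_right_gt.
  by apply: locally_bounded_limit_spectral => //; exact: counts_unbounded.
- exact: locally_bounded_limit_measure.
- by move=> c c0; rewrite limit_measure_itv0//; exact: cdf_limit_spectral.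
Unshelve. all: by end_near. Qed.

End regular_configuration.

Theorem proposition4p5 (R : realType) (alpha : R)
    (alpha_gt0 : 0 < alpha) (alpha_lt1 : alpha < 1)
    (d : measure_display) (T : measurableType d) (P : probability T R)
    (X : nat -> {RV P >-> R})
    (X_poisson : poisson_point_process P
       (fun w => point_measure (fun i => X i w)) (intensity alpha_gt0))
    (X_decreasing : {ae P, forall w, forall i : nat, X i.+1 w < X i w}) :
  {ae P, forall w, exists nu : R -> {measure set R -> \bar R},
    (forall tau0 : R, 0 < tau0 ->
       vague_cvg (ninfty_nbhs R)
         (fun E : R => spectral_measure (fun i => X i w) alpha tau0 E)
         (nu tau0)) /\
    vague_cvg (at_right (0 : R)) nu (limit_measure alpha_gt0)}.
Proof.
have counts : {ae P, forall w, forall m : nat, exists K, forall k, (K <= k)%N ->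
    exists2 n : nat, `|n%:R - k.+1%:R| <= m.+1%:R^-1 * k.+1%:R :> R &
    point_measure (fun i => X i w) `[level alpha k, +oo[%classic = n%:R%:E}.
  apply/ae_foralln => m; apply: (ae_counts X_poisson) => //.
  - by rewrite invf_le1// ler1n.
  - by move=> k; exact: intensity_level.
apply: filterS2 counts X_decreasing => w w_counts w_decr.
exists (limit_spectral (fun i => X i w) alpha); split; last exact: vague_cvg_limit_spectral.
move=> tau0 tau0_gt0; apply: vague_cvg_spectral => //.
exact: (counts_unbounded alpha_gt0).
Qed.
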